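(* Let $f:\mathbb{R}^n\to\mathbb{R}\cup\{+\infty\}$ be a proper lower semicontinuous function satisfying the standing assumptions listed in the context, with Łojasiewicz exponent $\theta$, and let $\{\mathbf{x}_t\}_{t\in\mathbb{N}}$ be generated by the proximal algorithm. If $\{\mathbf{x}_t\}_{t\in\mathbb{N}}$ is bounded, then it converges to a critical point of $f$. Let $\mathbf{x}_\infty$ be the limit of $\{\mathbf{x}_t\}_{t\in\mathbb{N}}$. If $\theta\in(\frac12,1)$ and $f$ is convex, then $$f(\mathbf{x}_t)-f(\mathbf{x}_\infty)\le O\left(t^{\frac{1}{1-2\theta}}\right)\quad\text{as } t\to\infty.$$
   Context: $\|\cdot\|$ is the Euclidean norm; $\mathrm{dom} f=\{\mathbf{x}\in\mathbb{R}^n:-\infty<f(\mathbf{x})<+\infty\}$. Subdifferentials: for $\mathbf{x}\in\mathrm{dom} f$, the Fréchet subdifferential $\hat\partial f(\mathbf{x})$ is the set of $\mathbf{g}^*\in\mathbb{R}^n$ with $\liminf_{\mathbf{y}\ne\mathbf{x},\,\mathbf{y}\to\mathbf{x}}\frac{f(\mathbf{y})-f(\mathbf{x})-\langle\mathbf{g}^*,\mathbf{y}-\mathbf{x}\rangle}{\|\mathbf{x}-\mathbf{y}\|}\ge0$; $\hat\partial f(\mathbf{x})=\emptyset$ if $\mathbf{x}\notin\mathrm{dom} f$. The limiting subdifferential $\partial f(\mathbf{x})$ is the set of $\mathbf{g}\in\mathbb{R}^n$ for which there exist $\mathbf{x}_m\to\mathbf{x}$ with $f(\mathbf{x}_m)\to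 f(\mathbf{x})$ and $\mathbf{g}_m^*\in\hat\partial f(\mathbf{x}_m)$ with $\mathbf{g}_m^*\to\mathbf{g}$; its elements are called subgradients. For convex $f$, $\partial f(\mathbf{x})$ is the usual convex subdifferential. A critical point of $f$ is a point $\mathbf{x}_*$ with $\mathbf{0}\in\partial f(\mathbf{x}_* )$. Proximal algorithm: given $\mathbf{x}_0\in\mathbb{R}^n$ and step sizes $\eta_t>0$, $\mathbf{x}_{t+1}\in\arg\min_{\mathbf{z}}\left\{f(\mathbf{z})+\frac{1}{2\eta_t}\|\mathbf{z}-\mathbf{x}_t\|^2\right\}$ for $t=0,1,2,\dots$. Standing assumptions: (1) $f$ is continuous on $\mathrm{dom} f$; (2) (Łojasiewicz inequality with exponent $\theta\in[0,1)$) for any $\mathbf{x}_*\in\mathbb{R}^n$ with $\mathbf{0}\in\partial f(\mathbf{x}_* )$ there exist $\kappa,\mu>0$ such that $|f(\mathbf{x})-f(\mathbf{x}_* )|^\theta\le\kappa\|\mathbf{g}\|$ for all $\mathbf{x}$ in the ball of radius $\mu$ centered at $\mathbf{x}_*$ and all $\mathbf{g}\in\partial f(\mathbf{x})$; (3) $\inf_{\mathbf{x}\in\mathbb{R}^n}f(\mathbf{x})>-\infty$; (4) the sequence $\{\mathbf{x}_t\}_t$ generated by the algorithm is bounded; (5) there exist $\eta_-,\eta_+\in(0,\infty)$ such that $\eta_-\le\eta_t\le\eta_+$ for all $t$. *)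

(* Defs.v *)
(* MathComp-Analysis development: R^n is 'rV[R]_n over an abstract R : realType.
   Its library topology is the usual one, but its library norm is the sup norm,
   whence [enorm] below. *)
From HB Require Import structures.
From mathcomp Require Import all_boot all_order all_algebra.
From mathcomp Require Import all_classical all_reals all_analysis.
Set Implicit Arguments.
Unset Strict Implicit.
Unset Printing Implicit Defensive.
Import Order.TTheory GRing.Theory Num.Theory.
Import numFieldNormedType.Exports.

Local Open Scope classical_set_scope.
Local Open Scope ring_scope.

Definition dotv (R : realType) (n : nat) (u v : 'rV[R]_n) : R :=
  \sum_(i < n) u 0 i * v 0 i.

Definition enorm (R : realType) (n : nat) (u : 'rV[R]_n) : R :=
  Num.sqrt (dotv u u).

Definition dom (R : realType) (n : nat) (f : 'rV[R]_n -> \bar R) :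
    set 'rV[R]_n :=
  [set x | (-oo < f x)%E /\ (f x < +oo)%E].

(* A proper function into R U {+oo}: it never takes the value -oo and is not
   identically +oo. *)
Definition proper_function (R : realType) (n : nat) (f : 'rV[R]_n -> \bar R) : Prop :=
  (forall x, (-oo < f x)%E) /\ (exists x, (f x < +oo)%E).

(* At t = 0 and t = 1 the convention 0 * +oo = 0 makes the inequality trivial. *)
Definition econvex (R : realType) (n : nat) (f : 'rV[R]_n -> \bar R) : Prop :=
  forall (x y : 'rV[R]_n) (t : R), 0 <= t <= 1 ->
    (f (t *: x + (1 - t) *: y)%R <= t%:E * f x + (1 - t)%:E * f y)%E.

(* x^' is the punctured neighbourhood filter of x, so that the liminf is taken
   over y -> x with y != x. *)
Definition frechet_subdiff (R : realType) (n : nat) (f : 'rV[R]_n -> \bar R)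
    (x : 'rV[R]_n) : set 'rV[R]_n :=
  [set g | dom f x /\
    (0 <= limf_einf (fun y : 'rV[R]_n =>
            (f y - f x - (dotv g (y - x)%R)%:E)
              * ((enorm (x - y)%R)^-1)%:E) (x^'))%E].

(* As for the Frechet subdifferential, the limiting one is empty outside
   [dom f]. *)
Definition limiting_subdiff (R : realType) (n : nat) (f : 'rV[R]_n -> \bar R)
    (x : 'rV[R]_n) : set 'rV[R]_n :=
  [set g | dom f x /\
    exists (u : nat -> 'rV[R]_n) (h : nat -> 'rV[R]_n),
      [/\ u m @[m --> \oo] --> x,
          f (u m) @[m --> \oo] --> f x,
          (forall m, frechet_subdiff f (u m) (h m)) &
          h m @[m --> \oo] --> g]].

Definition critical_point (R : realType) (n : nat) (f : 'rV[R]_n -> \bar R)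
    (x : 'rV[R]_n) : Prop :=
  limiting_subdiff f x 0.

(* d to the power theta with the convention 0 ^ 0 = 0, usual for the
   Lojasiewicz inequality; [powR] has 0 `^ 0 = 1, which for theta = 0 would make
   the inequality fail at the critical point itself (with g = 0). *)
Definition pow0 (R : realType) (d theta : R) : R :=
  if d == 0 then 0 else d `^ theta.

(* [fine] is harmless: a point with a limiting subgradient lies in [dom f]. *)
Definition lojasiewicz (R : realType) (n : nat) (f : 'rV[R]_n -> \bar R)
    (theta : R) : Prop :=
  forall xs : 'rV[R]_n, critical_point f xs ->
    exists kappa mu : R, [/\ 0 < kappa, 0 < mu &
      forall x g : 'rV[R]_n, enorm (x - xs) < mu -> limiting_subdiff f x g ->
        pow0 `|fine (f x) - fine (f xs)| theta <= kappa * enorm g].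

Definition argmin (R : realType) (n : nat) (F : 'rV[R]_n -> \bar R) :
    set 'rV[R]_n :=
  [set y | forall z, (F y <= F z)%E].

Definition proximal_sequence (R : realType) (n : nat)
    (f : 'rV[R]_n -> \bar R) (eta : nat -> R) (x : nat -> 'rV[R]_n) : Prop :=
  forall t : nat,
    argmin (fun z : 'rV[R]_n =>
      (f z + ((2 * eta t)^-1 * enorm (z - x t) ^+ 2)%:E)%E) (x t.+1).

(* Main.v *)
Require Import Defs.
From HB Require Import structures.
From mathcomp Require Import all_boot all_order all_algebra.
From mathcomp Require Import all_classical all_reals all_analysis.
From mathcomp Require Import zify ring lra.
Import Order.TTheory GRing.Theory Num.Theory.
Import numFieldNormedType.Exports.
Local Open Scope classical_set_scope.
Local Open Scope ring_scope.

Set Implicit Arguments.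
Unset Strict Implicit.

(** Write [s_t = |x_(t+1) - x_t|] and [d_t = f(x_(t+1)) - f(a)], where [a] is a
    cluster point of the bounded sequence [x]. The proof is the
    Kurdyka--Lojasiewicz argument for descent methods. It uses three facts.

    - Comparing the minimizer [x_(t+1)] with the candidate [x_t] gives the
      descent estimate [s_t^2 <= 2 eta_t (f(x_t) - f(x_(t+1)))] as soon as
      [f(x_t)] is finite, hence for [t >= 1] ([prox_descent]).
    - The vector [(x_t - x_(t+1)) / eta_t] is a Frechet subgradient of [f] at
      [x_(t+1)], of norm at most [s_t / eta_lo] ([prox_frechet_subdiff]).
    - Lower semicontinuity puts [a] in the domain; continuity there and the
      monotonicity of the values then give that [d_t] decreases to 0
      ([lsc_decreasing_cluster]). Hence the steps and the subgradients tend to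
      0, and [a] is critical ([critical_point_cluster]).

    Near [a] the Lojasiewicz inequality now reads [d_t^theta <= K s_t].
    Concavity of [r |-> r^(1 - theta)] combines it with the descent estimate
    into [2 s_(t+1) <= s_t + (phi_t - phi_(t+1))], where [phi_t] is a multiple
    of [d_t^(1 - theta)] ([lojasiewicz_step]). This telescopes: as long as the
    iterates stay near [a], their total length after time [T] is at most
    [s_T + phi_T]. For any radius [e], one iterate close to [a], late enough
    for [s_T + phi_T] to be small, therefore traps all later iterates in the
    ball of radius [e] ([trapped_of_small_start]). Since [a] is a cluster point
    such an iterate exists, so the sequence converges to [a].

    For the rate, [d_(t+1)^theta <= K s_(t+1)] and
    [s_(t+1)^2 <= c (d_t - d_(t+1))] give
    [d_(t+1) + (K^2 c)^-1 d_(t+1)^(2 theta) <= d_t], a discrete version of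
    [d' = - C d^(1 + p)] with [p = 2 theta - 1], whose solutions decay like
    [t^(-1/p)] ([sublinear_decay]). *)

(** * The Euclidean norm *)

Lemma dotvC (R : realType) n (u v : 'rV[R]_n) : dotv u v = dotv v u.
Proof. by apply: eq_bigr => i _; rewrite mulrC. Qed.

Lemma dotvDl (R : realType) n (u v w : 'rV[R]_n) :
  dotv (u + v) w = dotv u w + dotv v w.
Proof. by rewrite /dotv -big_split/=; apply: eq_bigr => i _; rewrite mxE mulrDl. Qed.

Lemma dotvZl (R : realType) n (a : R) (u v : 'rV[R]_n) :
  dotv (a *: u) v = a * dotv u v.
Proof. by rewrite /dotv mulr_sumr; apply: eq_bigr => i _; rewrite mxE mulrA. Qed.

Lemma dotvNl (R : realType) n (u v : 'rV[R]_n) : dotv (- u) v = - dotv u v.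
Proof. by rewrite -scaleN1r dotvZl mulN1r. Qed.

Lemma dotvDr (R : realType) n (u v w : 'rV[R]_n) :
  dotv w (u + v) = dotv w u + dotv w v.
Proof. by rewrite dotvC dotvDl !(dotvC _ w). Qed.

Lemma dotvNr (R : realType) n (u v : 'rV[R]_n) : dotv u (- v) = - dotv u v.
Proof. by rewrite dotvC dotvNl dotvC. Qed.

Lemma dotvZr (R : realType) n (a : R) (u v : 'rV[R]_n) :
  dotv u (a *: v) = a * dotv u v.
Proof. by rewrite dotvC dotvZl dotvC. Qed.

Lemma dotv_ge0 (R : realType) n (u : 'rV[R]_n) : 0 <= dotv u u.
Proof. by apply: sumr_ge0 => i _; rewrite -expr2 sqr_ge0. Qed.

Lemma enorm_ge0 (R : realType) n (u : 'rV[R]_n) : 0 <= enorm u.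
Proof. exact: sqrtr_ge0. Qed.

Lemma enorm_sqr (R : realType) n (u : 'rV[R]_n) : enorm u ^+ 2 = dotv u u.
Proof. by rewrite sqr_sqrtr// dotv_ge0. Qed.

Lemma enormN (R : realType) n (u : 'rV[R]_n) : enorm (- u) = enorm u.
Proof. by rewrite /enorm dotvNl dotvNr opprK. Qed.

Lemma enormB (R : realType) n (u v : 'rV[R]_n) : enorm (u - v) = enorm (v - u).
Proof. by rewrite -enormN opprB. Qed.

Lemma enorm0 (R : realType) n : enorm (0 : 'rV[R]_n) = 0.
Proof. by rewrite /enorm /dotv big1 ?sqrtr0// => i _; rewrite mxE mul0r. Qed.

Lemma enormZ (R : realType) n (a : R) (u : 'rV[R]_n) :
  0 <= a -> enorm (a *: u) = a * enorm u.
Proof.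
move=> a0; rewrite /enorm dotvZl dotvZr mulrA -expr2 sqrtrM ?sqr_ge0//.
by rewrite sqrtr_sqr ger0_norm.
Qed.

(** The topology of row vectors is that of the sup norm; this bound and
    [ler_enorm_norm] transfer neighbourhoods and limits to [enorm]. *)
Lemma ler_norm_enorm (R : realType) n (u : 'rV[R]_n) : `|u| <= enorm u.
Proof.
rewrite /Num.Def.normr/= mx_normrE; apply/bigmax_leP; split; first exact: enorm_ge0.
move=> [i j] _ /=; rewrite ord1 -sqrtr_sqr ler_wsqrtr//.
rewrite /dotv (bigD1 j)//= -expr2 lerDl.
by apply: sumr_ge0 => k _; rewrite -expr2 sqr_ge0.
Qed.

Lemma ler_enorm_norm (R : realType) n (u : 'rV[R]_n) :
  enorm u <= Num.sqrt n%:R * `|u|.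
Proof.
rewrite -[leRHS]ger0_norm ?mulr_ge0 ?sqrtr_ge0// -sqrtr_sqr ler_wsqrtr//.
rewrite exprMn sqr_sqrtr// -[n in n%:R]card_ord -sum1_card natr_sum.
rewrite mulr_suml; apply: ler_sum => i _; rewrite mul1r -expr2.
rewrite -(@ger0_norm _ (u 0 i ^+ 2)) ?sqr_ge0// normrX lerXn2r ?nnegrE//.
rewrite [leRHS]/Num.Def.normr/= mx_normrE.
exact: (@le_bigmax _ _ _ 0 (fun ij => `|u ij.1 ij.2|) (0, i)).
Qed.

Lemma enorm_eq0 (R : realType) n (u : 'rV[R]_n) : enorm u = 0 -> u = 0.
Proof.
by move=> u0; apply/eqP; rewrite -normr_le0 -u0 ler_norm_enorm.
Qed.

(** Cauchy--Schwarz, from [0 <= |b u - a v|^2] where [a] and [b] are the norms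
    of [u] and [v]. *)
Lemma dotv_le_enorm (R : realType) n (u v : 'rV[R]_n) :
  dotv u v <= enorm u * enorm v.
Proof.
have [u0|u0] := eqVneq (enorm u) 0.
  by rewrite u0 (enorm_eq0 u0) -(scale0r 0) dotvZl !mul0r.
have [v0|v0] := eqVneq (enorm v) 0.
  by rewrite v0 (enorm_eq0 v0) -(scale0r 0) dotvZr mul0r mulr0.
have := dotv_ge0 (enorm v *: u - enorm u *: v).
rewrite dotvDl !dotvDr dotvNl !dotvNr dotvNl !(dotvZl, dotvZr) -!enorm_sqr.
rewrite (dotvC v u).
have uv0 : 0 < enorm u * enorm v by rewrite mulr_gt0// lt0r ?u0 ?v0 enorm_ge0.
rewrite [leRHS](_ : _ =
    2 * (enorm u * enorm v) * (enorm u * enorm v - dotv u v)); last by ring.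
by rewrite pmulr_rge0 ?subr_ge0// mulr_gt0.
Qed.

Lemma ler_enormD (R : realType) n (u v : 'rV[R]_n) :
  enorm (u + v) <= enorm u + enorm v.
Proof.
rewrite -[leRHS]ger0_norm ?addr_ge0 ?enorm_ge0// -sqrtr_sqr ler_wsqrtr//.
rewrite dotvDl !dotvDr -!enorm_sqr (dotvC v u).
have := dotv_le_enorm u v; nra.
Qed.

Lemma nbhs_enorm (R : realType) n (a : 'rV[R]_n) (e : R) :
  0 < e -> nbhs a [set y | enorm (y - a) < e].
Proof.
move=> e0; apply/nbhs_ballP; exists (e / (Num.sqrt n%:R + 1)).
  by rewrite /= divr_gt0// ltr_wpDl// sqrtr_ge0.
move=> y; rewrite mx_norm_ball /ball_/= => ye.
have s0 : 0 <= Num.sqrt n%:R :> R by exact: sqrtr_ge0.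
rewrite ltr_pdivlMr ?ltr_wpDl// in ye.
rewrite enormB; apply: le_lt_trans ye.
apply: (le_trans (ler_enorm_norm _)).
by rewrite mulrC ler_wpM2l// lerDl.
Qed.

Lemma cvg_enorm (R : realType) n (u : nat -> 'rV[R]_n) (a : 'rV[R]_n) :
  (forall e, 0 < e -> \forall t \near \oo, enorm (u t - a) < e) ->
  u t @[t --> \oo] --> a.
Proof.
move=> ua; apply/cvgrPdist_lt => e e0; near=> t.
rewrite distrC; apply: (le_lt_trans (ler_norm_enorm _)).
by near: t; exact: ua.
Unshelve. all: by end_near. Qed.

Lemma enorm_bounded_cluster (R : realType) n (u : nat -> 'rV[R]_n) (M : R) :
  (forall t, enorm (u t) <= M) ->
  exists a : 'rV[R]_n, forall U, nbhs a U -> forall N : nat, exists2 t, (N <= t)%N & U (u t).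
Proof.
move=> uM.
have cA : compact [set z : 'rV[R]_n | forall i, `[- M, M]%classic (z 0 i)].
  by apply: (@rV_compact R n (fun=> `[- M, M]%classic)) => _; exact: segment_compact.
have [] := cA (u t @[t --> \oo]) _.
  exists 0%N => // t _ i /=; rewrite in_itv/= -ler_norml.
  apply: le_trans (uM t); apply: le_trans (ler_norm_enorm _).
  rewrite [leRHS]/Num.Def.normr/= mx_normrE.
  exact: (@le_bigmax _ _ _ 0 (fun ij => `|u t ij.1 ij.2|) (0, i)).
move=> a [_ clu]; exists a => U aU N.
have [|_ [[t Nt <-] Ut]] := clu (u @` [set t | (N <= t)%N]) U _ aU.
  by exists N => // t Nt; exists t.
by exists t.
Qed.

(** * Inequalities for real powers *)

(** Bernoulli's inequality for exponents in ]0, 1]: Young's inequality for the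
    product of [v ^ p] and 1 with conjugate exponents [1 / p] and
    [1 / (1 - p)]. *)
Lemma powR_bernoulli (R : realType) (v p : R) :
  0 <= v -> 0 < p <= 1 -> v `^ p <= 1 + p * (v - 1).
Proof.
move=> v0 /andP[p0]; rewrite le_eqVlt => /predU1P[->|p1].
  by rewrite powRr1//; lra.
have := @conjugate_powR R (v `^ p) 1 p^-1 (1 - p)^-1 (powR_ge0 _ _) ler01.
rewrite !invrK -powRrM mulfV ?gt_eqF// powRr1// powR1 !invr_gt0 subr_gt0.
move=> /(_ p0 p1); lra.
Qed.

(** The concave function [r |-> r ^ (1 - theta)] lies below its tangent at [a];
    both sides are multiplied by [a ^ theta], so that no negative power
    occurs. *)
Lemma powR_concave_gradient (R : realType) (a b theta : R) :
  0 < a -> 0 <= b -> 0 <= theta < 1 ->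
  (1 - theta) * (a - b) <= a `^ theta * (a `^ (1 - theta) - b `^ (1 - theta)).
Proof.
move=> a0 b0 /andP[th0 th1].
have := @powR_bernoulli R (b / a) (1 - theta).
rewrite divr_ge0 ?(ltW a0)// => /(_ isT) /(_ ltac:(lra)) B.
have -> : b `^ (1 - theta) = a `^ (1 - theta) * (b / a) `^ (1 - theta).
  by rewrite -powRM ?divr_ge0 ?(ltW a0)// mulrC divfK ?gt_eqF.
have E : a `^ theta * a `^ (1 - theta) = a.
  rewrite -powRD; last by rewrite (gt_eqF a0) implybT.
  by rewrite addrC subrK powRr1// ltW.
have -> : a `^ theta * (a `^ (1 - theta) - a `^ (1 - theta) * (b / a) `^ (1 - theta))
   = a * (1 - (b / a) `^ (1 - theta)) by rewrite mulrBr mulrA E mulrBr mulr1.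
have : a * (b/a) `^ (1 - theta) <= a * (1 + (1 - theta) * (b / a - 1)).
  by rewrite ler_pM2l.
have -> : a * (1 + (1 - theta) * (b / a - 1)) = a + (1 - theta) * (b - a).
  by field; rewrite gt_eqF.
lra.
Qed.

(** * Subgradients and the proximal step *)

Lemma dom_fineK (R : realType) n (f : 'rV[R]_n -> \bar R) (x : 'rV[R]_n) :
  dom f x -> (fine (f x))%:E = f x.
Proof. by move=> [x1 x2]; rewrite fineK// fin_real// x1. Qed.

(** A quadratic defect [c |y - x|^2] is negligible against [|y - x|], so a
    quadratic minorant of [f] touching it at [x] has its slope in the Frechet
    subdifferential. *)
Lemma frechet_subdiff_quadratic (R : realType) n (f : 'rV[R]_n -> \bar R)
    (x g : 'rV[R]_n) (c : R) : 0 <= c -> dom f x ->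
  (forall y, (f x + (dotv g (y - x) - c * enorm (y - x) ^+ 2)%:E <= f y)%E) ->
  frechet_subdiff f x g.
Proof.
move=> c0 dx minor; split=> //; apply/lee_addgt0Pr => e e0.
rewrite limf_einfE -leeBlDr//; apply: le_trans; last first.
  apply: ereal_sup_ubound; exists [set y | enorm (y - x) < e / (c + 1)]; last by [].
  by apply: nbhs_dnbhs; apply: nbhs_enorm; rewrite divr_gt0// ltr_wpDl.
apply: le_ereal_inf_tmp => _ [y /= yx <-].
have := minor y; rewrite -(dom_fineK dx); rewrite (enormB x y).
set r := enorm (y - x) in yx *.
have r0 : 0 <= r by exact: enorm_ge0.
have ri0 : 0 <= r^-1 by rewrite invr_ge0.
rewrite ltr_pdivlMr ?ltr_wpDl// in yx.
case: (f y) => [v| |] //=.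
- rewrite -!EFinD -EFinM !lee_fin => h.
  have : - c * r ^+ 2 * r^-1 <= (v - fine (f x) - dotv g (y - x)) * r^-1.
    by rewrite ler_wpM2r//; lra.
  (* At r = 0 the quotient is 0, the inverse of 0 being 0. *)
  have [->|rn0] := eqVneq r 0; first by rewrite invr0 !mulr0; lra.
  rewrite expr2 -!mulrA mulfV// mulr1; nra.
- move=> _; rewrite !addye//.
  have [->|rn0] := eqVneq r 0; first by rewrite invr0 mule0 add0e lee_fin oppr_le0 ltW.
  by rewrite gt0_mulye ?leey// lte_fin invr_gt0 lt0r rn0.
Qed.

Section prox_step.
Context {R : realType} {n : nat} {f : 'rV[R]_n -> \bar R} {eta : R} {x y : 'rV[R]_n}.
Hypotheses (f_proper : proper_function f) (eta0 : 0 < eta).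
Hypothesis y_prox :
  argmin (fun z => (f z + ((2 * eta)^-1 * enorm (z - x) ^+ 2)%:E)%E) y.

Lemma prox_dom : dom f y.
Proof.
case: f_proper => fNy [z fz]; split; first exact: fNy.
have := le_lt_trans (y_prox z) (lte_add_pinfty fz (ltry _)).
by case: (f y) => [r| |] /=; rewrite ?ltry ?ltxx.
Qed.

Lemma prox_descent : dom f x ->
  enorm (y - x) ^+ 2 <= 2 * eta * (fine (f x) - fine (f y)).
Proof.
move=> dx; have := y_prox x.
rewrite subrr enorm0 expr0n mulr0 adde0 -(dom_fineK dx) -(dom_fineK prox_dom).
rewrite -EFinD lee_fin => h.
rewrite mulrC -ler_pdivrMr ?mulr_gt0// mulrC; lra.
Qed.

(** Expanding [|z - x|^2] around [y] turns minimality of [y] into a quadratic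
    minorant of [f] at [y] with defect [(2 * eta)^-1 |z - y|^2]. *)
Lemma prox_frechet_subdiff : frechet_subdiff f y (eta^-1 *: (x - y)).
Proof.
have dy := prox_dom.
apply: (@frechet_subdiff_quadratic _ _ _ _ _ (2 * eta)^-1) => //.
  by rewrite invr_ge0 mulr_ge0// ltW.
move=> z; have := y_prox z; rewrite -(dom_fineK dy).
case: (f z) (f_proper.1 z) => [v _| _ _|]; last by rewrite ltxx.
  2: by rewrite leey.
rewrite -!EFinD !lee_fin => h.
have E : (2 * eta)^-1 * enorm (z - x) ^+ 2 =
    (2 * eta)^-1 * enorm (y - x) ^+ 2 + (2 * eta)^-1 * enorm (z - y) ^+ 2
    - dotv (eta^-1 *: (x - y)) (z - y).
  have -> : z - x = (z - y) - (x - y) by rewrite opprB addrA subrK.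
  rewrite (enormB y x) !enorm_sqr; move: (z - y) (x - y) => w w'.
  rewrite dotvZl dotvDl !dotvDr !dotvNl !dotvNr (dotvC w w').
  by field; rewrite gt_eqF.
lra.
Qed.

End prox_step.

Lemma frechet_limiting_subdiff (R : realType) n (f : 'rV[R]_n -> \bar R)
    (x : 'rV[R]_n) : frechet_subdiff f x `<=` limiting_subdiff f x.
Proof.
move=> g gx; split; first by case: gx.
by exists (fun=> x), (fun=> g); split=> //; exact: cvg_cst.
Qed.

(** * Cluster points *)

(** A decreasing sequence of values can be compared at any time with its values
    along the iterates close to [a]: lower semicontinuity at [a] bounds all of
    it from below by [f a], and continuity on the domain brings it close to
    [f a]. *)
Lemma lsc_decreasing_cluster (R : realType) n (f : 'rV[R]_n -> \bar R)
    (u : nat -> 'rV[R]_n) (F : nat -> R) (a : 'rV[R]_n) :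
  (-oo < f a)%E -> lower_semicontinuous f -> {within dom f, continuous f} ->
  (forall t, f (u t) = (F t)%:E) -> nonincreasing_seq F ->
  (forall U, nbhs a U -> forall N : nat, exists2 t, (N <= t)%N & U (u t)) ->
  [/\ dom f a, forall t, fine (f a) <= F t & F t @[t --> \oo] --> fine (f a)].
Proof.
move=> fNy lsc fcont fF Fdec clu.
have lb b : (b%:E < f a)%E -> forall t, b < F t.
  move=> /lsc [V aV Vb] t; have [t' tt' Vt'] := clu _ aV t.
  by apply: lt_le_trans (Fdec _ _ tt'); rewrite -lte_fin -fF; exact: Vb.
have da : dom f a.
  split=> //; rewrite ltNge leye_eq; apply/negP => /eqP fa.
  by have := lb (F 0%N); rewrite fa ltry => /(_ isT 0%N); rewrite ltxx.
have le_F t : fine (f a) <= F t.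
  apply/ler_addgt0Pr => e e0; rewrite -lerBlDr; apply/ltW/lb.
  by rewrite -[ltRHS](dom_fineK da) lte_fin ltrBlDr ltrDl.
split=> //; apply/cvgrPdist_lt => e e0.
have : nbhs (f a) [set z | (z < (fine (f a) + e)%:E)%E].
  rewrite -[in nbhs _](dom_fineK da).
  apply: (@nbhs_open_ereal_lt _ _ (fun r => r + e)).
  by rewrite ltrDl.
move/subspace_continuousP : fcont => /(_ _ da) /[apply].
rewrite /= => /clu /(_ 0%N) [N _ FN]; exists N => // t /= Nt.
rewrite distrC ger0_norm ?subr_ge0// ltrBlDl.
apply: le_lt_trans (Fdec _ _ Nt) _; rewrite -lte_fin -fF.
apply: FN; split; first by rewrite fF ltNyr.
by rewrite fF ltry.
Qed.

(** Criticality of [a] needs a subsequence converging to [a], extracted from the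
    cluster property. *)
Lemma critical_point_cluster (R : realType) n (f : 'rV[R]_n -> \bar R)
    (u g : nat -> 'rV[R]_n) (F : nat -> R) (a : 'rV[R]_n) :
  dom f a -> (forall t, f (u t) = (F t)%:E) ->
  F t @[t --> \oo] --> fine (f a) ->
  (forall t, frechet_subdiff f (u t) (g t)) ->
  (forall e, 0 < e -> \forall t \near \oo, enorm (g t) < e) ->
  (forall U, nbhs a U -> forall N : nat, exists2 t, (N <= t)%N & U (u t)) ->
  critical_point f a.
Proof.
move=> da fF cvgF gF g0 clu.
have /choice[r rP] (m : nat) :
    exists t, (m <= t)%N /\ enorm (u t - a) < m.+1%:R^-1.
  by have [|t] := clu _ (nbhs_enorm a (_ : 0 < m.+1%:R^-1)) m; [|exists t].
have r_near (P : nat -> Prop) :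
    (\forall t \near \oo, P t) -> \forall m \near \oo, P (r m).
  case=> N _ NP; exists N => // m /= Nm; apply: NP => /=.
  exact: leq_trans Nm (rP m).1.
split=> //; exists (fun m => u (r m)), (fun m => g (r m)); split.
- apply: cvg_enorm => e e0.
  have /cvgrPdist_lt /(_ _ e0) := @cvg_harmonic R; apply: filterS => m.
  rewrite sub0r normrN ger0_norm ?harmonic_ge0//.
  exact: lt_trans (rP m).2.
- rewrite -(dom_fineK da).
  under eq_fun do rewrite fF.
  apply: cvg_EFin; first exact: nearW.
  apply/cvgrPdist_lt => e e0; apply: (r_near (fun t => `|fine (f a) - F t| < e)).
  by have /cvgrPdist_lt /(_ _ e0) := cvgF.
- by move=> m; exact: gF.
- apply: cvg_enorm => e e0; apply: (r_near (fun t => enorm (g t - 0) < e)).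
  by have := g0 _ e0; apply: filterS => t; rewrite subr0.
Qed.

(** * Finite length and trapping *)

(** While [y] stays in the ball, the recursion says that
    [enorm (y t - a) + s t + phi t] does not increase: one half of [2 * s t.+1]
    pays for the displacement, the other half replaces [s t]. So the
    iterates never leave the ball. *)
Lemma trapped_of_small_start (R : realType) n (y : nat -> 'rV[R]_n) (a : 'rV[R]_n)
    (s phi : nat -> R) (e : R) (T : nat) :
  (forall t, enorm (y t.+1 - y t) <= s t.+1) ->
  (forall t, 0 <= s t) -> (forall t, 0 <= phi t) ->
  (forall t, enorm (y t - a) < e -> 2 * s t.+1 <= s t + (phi t - phi t.+1)) ->
  enorm (y T - a) + s T + phi T < e ->
  forall t, (T <= t)%N -> enorm (y t - a) < e.
Proof.
move=> ys s0 phi0 rec start.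
suff H k : enorm (y (T + k)%N - a) + s (T + k)%N + phi (T + k)%N < e.
  move=> t Tt; have := H (t - T)%N; rewrite subnKC//.
  have := s0 t; have := phi0 t; lra.
elim: k => [|k IH]; first by rewrite addn0.
rewrite addnS.
have := rec (T + k)%N; have := s0 (T + k)%N; have := phi0 (T + k)%N.
have := ler_enormD (y (T + k).+1 - y (T + k)%N) (y (T + k)%N - a).
rewrite addrA subrK; have := ys (T + k)%N.
move=> h1 h2 h3 h4 /(_ ltac:(lra)); lra.
Qed.

(** With [D] the difference of the two powers, tangency gives
    [s' ^ 2 <= s * (c * K / (1 - theta) * D)], and the arithmetic-geometric
    mean inequality separates the product. When [a = 0] the descent estimate
    alone forces [s' = 0]. *)
Lemma lojasiewicz_step (R : realType) (theta c K a b s s' : R) :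
  0 <= theta < 1 -> 0 <= c -> 0 <= s -> 0 <= a -> 0 <= b -> b <= a ->
  s' ^+ 2 <= c * (a - b) -> pow0 a theta <= K * s ->
  2 * s' <= s + c * K / (1 - theta) * (a `^ (1 - theta) - b `^ (1 - theta)).
Proof.
move=> th c0 s0 a0 b0 ba s's; rewrite /pow0.
have [th0 th1] := andP th.
have [az _|an0 aK] := eqVneq a 0.
  have -> : b = a by lra.
  rewrite subrr mulr0; move: s's.
  have -> : a - b = 0 by lra.
  rewrite mulr0; nra.
have th1' : 0 < 1 - theta by lra.
have ap : 0 < a by rewrite lt0r an0.
have := powR_concave_gradient ap b0 th.
set D := _ - b `^ _ => grad.
have D0 : 0 <= D by rewrite subr_ge0 ge0_ler_powR// ?ltW.
set E := c * K / (1 - theta) * D.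
have sE : s' ^+ 2 <= s * E.
  apply: (le_trans s's).
  have -> : s * E = c * (K * s * D / (1 - theta)) by rewrite /E; ring.
  rewrite ler_wpM2l// ler_pdivlMr// mulrC.
  by apply: (le_trans grad); rewrite ler_wpM2r.
have E0 : 0 <= s + E.
  rewrite addr_ge0// mulr_ge0// divr_ge0 ?(ltW th1')//.
  rewrite mulr_ge0//; have : 0 < K * s by rewrite (lt_le_trans _ aK)// powR_gt0.
  nra.
have [|s'0] := leP s' 0; first lra.
rewrite -ler_sqr ?nnegrE//; last by rewrite mulr_ge0// ltW.
have := sqr_ge0 (s - E); rewrite !expr2 in sE *; lra.
Qed.

(** * Decay rates *)

(** A discrete comparison with the equation [d' = - c d ^ (1 + p)], along which
    [d ^ (- p)] grows linearly. The estimate on one step is kept in the form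
    [d' ^ p * (1 + c' * d ^ p) <= d ^ p], with [d'] the next value: it means
    [d' ^ (- p) >= d ^ (- p) + c'] and remains meaningful when [d] vanishes. *)
Lemma sublinear_decay (R : realType) (d : nat -> R) (c p : R) :
  0 < c -> 0 < p <= 1 -> (forall t, 0 <= d t) ->
  (forall t, d t.+1 + c * d t.+1 `^ (1 + p) <= d t) ->
  exists2 M : R, 0 < M & forall k : nat, k%:R * d k `^ p <= M.
Proof.
move=> c0 /andP[p0 p1] d0 rec.
pose S := d 0%N `^ p.
pose c' := p * c / (1 + c * S).
have S0 : 0 <= S by exact: powR_ge0.
have cS0 : 0 < 1 + c * S by rewrite ltr_wpDr// mulr_ge0// ltW.
have c'0 : 0 < c' by rewrite divr_gt0// mulr_gt0.
have dec t : d t.+1 <= d t.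
  by apply: le_trans (rec t); rewrite lerDl mulr_ge0 ?powR_ge0// ltW.
have dS t : d t `^ p <= S.
  elim: t => // t IH; apply: le_trans IH.
  by rewrite ge0_ler_powR// ?nnegrE// ltW.
have key t : d t.+1 `^ p * (1 + c' * d t `^ p) <= d t `^ p.
  set b := d t.+1 `^ p; set a := d t `^ p.
  have b0 : 0 <= b by exact: powR_ge0.
  have bS : b <= S by exact: dS.
  have cb0 : 0 < 1 + c * b by rewrite ltr_wpDr// mulr_ge0// ltW.
  have ba : b * (1 + c * b) `^ p <= a.
    rewrite -powRM ?(ltW cb0)// ge0_ler_powR ?nnegrE ?(ltW p0)//.
      by rewrite mulr_ge0// ltW.
    apply: le_trans (rec t); rewrite mulrDr mulr1 lerD2l mulrCA ler_pM2l//.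
    have [->|dn0] := eqVneq (d t.+1) 0; first by rewrite mul0r powR_ge0.
    by rewrite powRD ?powRr1//; rewrite (negbTE dn0) implybT.
  (* Bernoulli at the inverse of 1 + c b bounds the growth of its p-th power
     from below; c' is the slope needed at the largest value S of b. *)
  have B : 1 <= (1 + c * b) `^ p * (1 - c' * b).
    have := @powR_bernoulli R (1 + c * b)^-1 p; rewrite invr_ge0 (ltW cb0) p0 p1.
    move=> /(_ isT isT).
    have -> : (1 + c * b)^-1 - 1 = - (c * b / (1 + c * b)).
      by field; rewrite gt_eqF.
    have : c' * b <= p * (c * b / (1 + c * b)).
      rewrite /c' !mulrA mulrAC -!mulrA ler_wpM2l ?(ltW p0)// ler_wpM2l ?(ltW c0)//.
      rewrite ler_wpM2l// lef_pV2 ?posrE// lerD2l ler_wpM2l// ltW//.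
    set w := _ / _ => h1 h2.
    have h3 : (1 + c * b)^-1 `^ p <= 1 - c' * b by lra.
    have P0 : 0 < (1 + c * b) `^ p by rewrite powR_gt0.
    apply: le_trans (ler_wpM2l (ltW P0) h3).
    by rewrite -powRM ?invr_ge0 ?(ltW cb0)// mulfV ?gt_eqF// powR1.
  have P0 : 0 < (1 + c * b) `^ p by rewrite powR_gt0.
  have h0 : 0 <= 1 - c' * b.
    rewrite -(pmulr_rge0 _ P0); lra.
  suff : b <= a * (1 - c' * b) by lra.
  apply: le_trans (ler_wpM2r h0 ba).
  rewrite -mulrA; nra.
(* The induction invariant is k c' d_k^p <= 1. Its step uses that, for
   w = c' d_k^p, k w <= 1 implies (k + 1) w <= 1 + w. *)
exists c'^-1; first by rewrite invr_gt0.
move=> k; rewrite -[leRHS]mul1r ler_pdivlMr//.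
elim: k => [|k IH]; first by rewrite !mul0r.
set b := d k.+1 `^ p in key *; have := key k; rewrite -/b.
set a := d k `^ p in IH *; move=> K.
have a0 : 0 <= a by exact: powR_ge0.
have wa : 0 < 1 + c' * a by rewrite ltr_wpDr// mulr_ge0// ltW.
rewrite -(ler_pM2r wa) mul1r mulrAC.
have : k.+1%:R * c' * (b * (1 + c' * a)) <= k.+1%:R * c' * a.
  by rewrite ler_wpM2l// mulr_ge0// ltW.
rewrite -!(natr1 k).
have : 0 <= k%:R :> R by [].
lra.
Qed.

(** Squaring the Lojasiewicz inequality and inserting it in the descent estimate
    leaves a recursion on the values [d] alone. *)
Lemma lojasiewicz_rate (R : realType) (d s : nat -> R) (theta c K : R) :
  2^-1 < theta < 1 -> 0 < c -> 0 < K ->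
  (forall k, 0 <= d k) -> (forall k, 0 <= s k) ->
  (forall k, s k.+1 ^+ 2 <= c * (d k - d k.+1)) ->
  (forall k, pow0 (d k) theta <= K * s k) ->
  exists2 B : R, 0 < B & forall k : nat, k%:R * d k `^ (2 * theta - 1) <= B.
Proof.
move=> /andP[th2 th1] c0 K0 d0 s0 desc loj.
have Kc0 : 0 < K ^+ 2 * c by exact: mulr_gt0 (exprn_gt0 2 K0) c0.
have Ks0 k : 0 <= K * s k by rewrite mulr_ge0// ltW.
have p01 : 0 < 2 * theta - 1 <= 1 by rewrite subr_gt0 lerBlDr; lra.
apply: (@sublinear_decay _ d (K ^+ 2 * c)^-1) => //; first by rewrite invr_gt0.
move=> k; have -> : 1 + (2 * theta - 1) = theta * 2%:R by ring.
rewrite powRrM powR_mulrn ?powR_ge0//.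
have h : d k.+1 `^ theta <= K * s k.+1.
  have := loj k.+1; rewrite /pow0; case: eqP => // -> _.
  by rewrite powR0//; apply: lt0r_neq0; lra.
have h2 : (d k.+1 `^ theta) ^+ 2 <= K ^+ 2 * c * (d k - d k.+1).
  apply: (@le_trans _ _ ((K * s k.+1) ^+ 2)).
    by rewrite ler_pXn2r ?nnegrE ?powR_ge0.
  by rewrite exprMn -mulrA ler_wpM2l ?sqr_ge0.
by rewrite -lerBrDl mulrC ler_pdivrMr// mulrC.
Qed.

Lemma powR_rate (R : realType) (d M p tau : R) :
  0 < p -> 0 <= d -> 0 < tau -> tau * d `^ p <= M ->
  d <= M `^ p^-1 * tau `^ (- p^-1).
Proof.
move=> p0 d0 tau0 h.
have dE : d = (d `^ p) `^ p^-1 by rewrite -powRrM mulfV ?gt_eqF// powRr1.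
have M0 : 0 <= M by apply: le_trans h; rewrite mulr_ge0 ?powR_ge0// ltW.
have -> : tau `^ (- p^-1) = tau^-1 `^ p^-1.
  by rewrite -(powR_inv1 (ltW tau0)) -powRrM mulN1r.
rewrite -powRM ?invr_ge0 ?(ltW tau0)// [leLHS]dE ge0_ler_powR ?nnegrE ?powR_ge0//.
- by rewrite invr_ge0 ltW.
- by rewrite mulr_ge0// invr_ge0 ltW.
- by rewrite ler_pdivlMr// mulrC.
Qed.

(** * Convergence and rate of the proximal algorithm *)

Unset Implicit Arguments.

Theorem theorem9 (R : realType) (n : nat) (f : 'rV[R]_n -> \bar R)
    (theta : R) (eta : nat -> R) (x : nat -> 'rV[R]_n)
    (f_proper : proper_function f)
    (f_lsc : lower_semicontinuous f)
    (f_cont : {within dom f, continuous f})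
    (theta_range : 0 <= theta < 1)
    (f_loj : lojasiewicz f theta)
    (f_inf : (-oo < ereal_inf (range f))%E)
    (eta_gt0 : forall t, 0 < eta t)
    (eta_bounds : exists eta_lo eta_hi : R,
       [/\ 0 < eta_lo, 0 < eta_hi & forall t, eta_lo <= eta t <= eta_hi])
    (x_prox : proximal_sequence f eta x)
    (x_bounded : exists M : R, forall t, enorm (x t) <= M) :
  exists xinf : 'rV[R]_n,
    [/\ x t @[t --> \oo] --> xinf,
        critical_point f xinf &
        2^-1 < theta -> econvex f ->
          exists2 h : nat -> R,
            h =O_\oo (fun t : nat => t%:R `^ (1 - 2 * theta)^-1) &
            \forall t \near \oo, (f (x t) - f xinf <= (h t)%:E)%E].
Proof.
have [eta_lo [eta_hi [lo0 hi0 eta_b]]] := eta_bounds.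
have [M xM] := x_bounded.
have [th0 th1] := andP theta_range.
have xdom t : dom f (x t.+1) := prox_dom f_proper (x_prox t).
pose F t := fine (f (x t.+1)).
have fF t : f (x t.+1) = (F t)%:E by rewrite dom_fineK.
pose s t := enorm (x t.+1 - x t).
have s0 t : 0 <= s t := enorm_ge0 _.
pose g t := (eta t)^-1 *: (x t - x t.+1).
have gF t : frechet_subdiff f (x t.+1) (g t) :=
  prox_frechet_subdiff f_proper (eta_gt0 t) (x_prox t).
have gs t : enorm (g t) <= eta_lo^-1 * s t.
  rewrite enormZ ?invr_ge0 ?(ltW (eta_gt0 t))// enormB ler_wpM2r ?enorm_ge0//.
  by rewrite lef_pV2 ?posrE//; case/andP: (eta_b t).
have desc t : s t.+1 ^+ 2 <= 2 * eta t.+1 * (F t - F t.+1) :=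
  prox_descent f_proper (eta_gt0 t.+1) (x_prox t.+1) (xdom t).
have FS t : F t.+1 <= F t.
  have := le_trans (sqr_ge0 _) (desc t).
  by rewrite pmulr_rge0 ?subr_ge0// mulr_gt0.
have Fdec : nonincreasing_seq F by exact/nonincreasing_seqP.
pose c := 2 * eta_hi.
have c0 : 0 < c by rewrite mulr_gt0.
have sF t : s t.+1 ^+ 2 <= c * (F t - F t.+1).
  apply: (le_trans (desc t)); rewrite ler_wpM2r ?subr_ge0// ler_wpM2l//.
  by case/andP: (eta_b t.+1).
have [a clu] := @enorm_bounded_cluster _ _ (fun t => x t.+1) M (fun t => xM t.+1).
have [da leF cvgF] := lsc_decreasing_cluster (f_proper.1 a) f_lsc f_cont fF Fdec clu.
set l := fine (f a) in leF cvgF.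
have Flt e : 0 < e -> \forall t \near \oo, F t - l < e.
  move=> e0; have /cvgrPdist_lt /(_ _ e0) := cvgF; apply: filterS => t.
  by rewrite distrC ger0_norm// subr_ge0.
have slt e : 0 < e -> \forall t \near \oo, s t < e.
  move=> e0; have : \forall t \near \oo, s t.+1 < e.
    have /Flt : 0 < e ^+ 2 / c by rewrite divr_gt0// exprn_gt0.
    apply: filterS => t; rewrite ltr_pdivlMr// => h.
    rewrite -(@ltr_pXn2r _ 2%N) ?nnegrE ?(ltW e0)//.
    apply: (le_lt_trans (sF t)); apply: le_lt_trans h.
    by rewrite mulrC ler_wpM2r ?(ltW c0)// lerB.
  by case=> N _ H; exists N.+1 => // -[//|t] /= Nt; exact: H.
have crit : critical_point f a.
  apply: (critical_point_cluster da fF cvgF gF _ clu) => e e0.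
  have /slt : 0 < e * eta_lo by rewrite mulr_gt0.
  apply: filterS => t h; apply: (le_lt_trans (gs t)).
  by rewrite mulrC ltr_pdivrMr.
have [kappa [mu [kappa0 mu0 loj]]] := f_loj _ crit.
pose K := kappa / eta_lo.
have K0 : 0 < K by rewrite divr_gt0.
have lojs t : enorm (x t.+1 - a) < mu -> pow0 (F t - l) theta <= K * s t.
  move=> /loj /(_ (frechet_limiting_subdiff (gF t))).
  rewrite fF /= ger0_norm ?subr_ge0// => /le_trans; apply.
  by rewrite -mulrA ler_wpM2l// ltW.
pose C := c * K / (1 - theta).
have th1' : 0 < 1 - theta by rewrite subr_gt0.
have C0 : 0 < C by rewrite divr_gt0// mulr_gt0.
pose phi t := C * (F t - l) `^ (1 - theta).
have phi_lt e : 0 < e -> \forall t \near \oo, phi t < e.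
  move=> e0; have eC : 0 < e / C by rewrite divr_gt0.
  have /Flt : 0 < (e / C) `^ (1 - theta)^-1 by rewrite powR_gt0.
  apply: filterS => t h.
  rewrite /phi mulrC -ltr_pdivlMr//.
  have -> : e / C = ((e / C) `^ (1 - theta)^-1) `^ (1 - theta).
    by rewrite -powRrM mulVf ?gt_eqF// powRr1// ltW.
  by rewrite gt0_ltr_powR ?nnegrE ?powR_ge0// subr_ge0.
have rec t : enorm (x t.+1 - a) < mu -> 2 * s t.+1 <= s t + (phi t - phi t.+1).
  move=> /lojs h; rewrite -mulrBr.
  apply: lojasiewicz_step h => //; rewrite ?subr_ge0 ?lerB ?(ltW c0)//.
  by apply: (le_trans (sF t)); rewrite ler_pM2l//; lra.
have near_a e : 0 < e -> exists T, forall t, (T <= t)%N -> enorm (x t.+1 - a) < e.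
  move=> e0; pose e' := Num.min e mu.
  have e'0 : 0 < e' by rewrite lt_min e0.
  have e3 : 0 < e' / 3 by rewrite divr_gt0.
  (* The three summands of the starting condition each get a third of e'. *)
  have [N1 _ sN] := slt _ e3; have [N2 _ phiN] := phi_lt _ e3.
  have [T NT xT] := clu _ (nbhs_enorm a e3) (maxn N1 N2).
  have {}sN := sN T (leq_trans (leq_maxl _ _) NT).
  have {}phiN := phiN T (leq_trans (leq_maxr _ _) NT).
  exists T => t Tt; apply: (@lt_le_trans _ _ e'); last by rewrite ge_min lexx.
  apply: (@trapped_of_small_start _ _ (fun t => x t.+1) a s phi e' T) Tt => //.
  - by move=> t'; rewrite mulr_ge0 ?powR_ge0// ltW.
  - by move=> t' h; apply: rec; apply: lt_le_trans h _; rewrite ge_min lexx orbT.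
  - rewrite /= in sN phiN xT *; lra.
have cvgx : x t.+1 @[t --> \oo] --> a.
  by apply: cvg_enorm => e /near_a[T H]; exists T.
exists a; split=> //; first by rewrite -cvg_shiftS.
move=> th2 _.
have [T xT] := near_a _ mu0.
pose p := 2 * theta - 1.
have p0 : 0 < p by rewrite /p; lra.
pose d k := F (T + k)%N - l.
have d0 k : 0 <= d k by rewrite subr_ge0.
have desc_d k : s (T + k.+1)%N ^+ 2 <= c * (d k - d k.+1).
  rewrite addnS; apply: (le_trans (sF _)); rewrite ler_pM2l// /d addnS; lra.
have loj_d k : pow0 (d k) theta <= K * s (T + k)%N.
  exact: lojs (xT _ (leq_addr _ _)).
have [||B B0 dB] := lojasiewicz_rate _ c0 K0 d0 _ desc_d loj_d.
- by rewrite th2.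
- by move=> k; exact: s0.
exists (fun t => (2 * B) `^ p^-1 * t%:R `^ (1 - 2 * theta)^-1).
  apply/eqOP; exists ((2 * B) `^ p^-1); split; first by rewrite num_real.
  move=> b /ltW bB; apply: nearW => t.
  by rewrite normrM (ger0_norm (powR_ge0 _ _)) ler_wpM2r.
(* Only the t - T - 1 steps taken inside the ball count; for t >= 2 (T + 1)
   these are at least t / 2, whence the factor 2 in 2 * B. *)
exists (2 * T.+1)%N => // t /= Tt.
have -> : t = (T + (t - T.+1)).+1.
  by rewrite -addSn subnKC//; apply: leq_trans Tt; rewrite leq_pmull.
have : ((T + (t - T.+1)).+1 <= 2 * (t - T.+1))%N by clear -Tt; lia.
move: (t - T.+1)%N => k tk.
rewrite fF -(dom_fineK da) -EFinB lee_fin.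
have -> : (1 - 2 * theta)^-1 = - p^-1 by rewrite -invrN /p opprB.
apply: powR_rate => //; first exact: d0.
apply: (@le_trans _ _ ((2 * k)%:R * d k `^ p)).
  by rewrite ler_wpM2r ?powR_ge0// ler_nat.
by rewrite natrM -mulrA ler_pM2l.
Qed.
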